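(* Let $C_m$ be any Hermitian code with $q^2-q-1\le m\le 2q^2-2q-3$. Then its distance is $$d(m)=\widetilde\delta_m .$$ Moreover, there exist divisors in $\mathcal{M}_m$ that are cut on $\mathcal{H}$ by a suitable union of lines.
   Context: $q$ is a power of a prime, $A=\mathbb{F}_{q^2}[x,y]$, and $\mathcal{H}$ is the affine Hermitian curve defined by $H=x^{q+1}-y^q-y$. It has exactly $n=q^3$ points $P_1,\dots,P_n$ with coordinates in $\mathbb{F}_{q^2}$; $E=\{P_1,\dots,P_n\}$ and $A_E=A/\langle H,x^{q^2}-x,y^{q^2}-y\rangle$. Weights: $w(x^ry^s)=rq+s(q+1)$. $V_m\subseteq A_E$ is the span of the classes of monomials of weight $w\le m$, and the Hermitian code $C_m\subseteq(\mathbb{F}_{q^2})^n$ is the dual code of $\{(f(P_1),\dots,f(P_n)) : f\in V_m\}$. $d(m)$ is the distance of $C_m$, i.e. the minimum weight of its nonzero codewords. The support of a codeword $(c_1,\dots,c_n)$ is identified with the set of points $\{P_i: c_i\neq0\}\subseteq E$ (a divisor of distinct points on $\mathcal{H}$), and $\mathcal{M}_m$ is the set of supports of minimum-weight (nonzero) codewords of $C_m$. $\mathcal{B}=\{x^ry^s : 0\le r\le q,\ 0\le s\le q^2-q-1\}\cup\{y^s : q^2-q\le s\le q^2-1\}$, and $\Lambda_{\mathcal{B}}=\{w(x^ry^s): x^ry^s\in\mathcal{B}\}$. $\Lambda$ is the numerical semigroup generated by $q$ and $q+1$. Put $\delta(m)=m-q^2+q+2$. $\widetilde m$ denotes the minimum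 integer $m'\ge m$ such that both $m'+1\in\Lambda_{\mathcal{B}}$ and $\delta(m')\in\Lambda$; and $\widetilde\delta_m=\delta(\widetilde m)$. A divisor $D\subseteq E$ is cut on $\mathcal{H}$ by a curve $F=0$ ($F\in A$) if $D$ is the scheme-theoretic intersection of $\mathcal{H}$ and that curve in the affine plane, i.e. the ideal $I_D$ of polynomials vanishing on $D$ equals $\langle H,F\rangle$. A union of lines is a curve defined by a product of polynomials of degree $1$. *)

(* Defs.v *)
From mathcomp Require Import all_boot all_order all_algebra.
From mathcomp Require Export mpoly.

Set Implicit Arguments.
Unset Strict Implicit.
Unset Printing Implicit Defensive.

Import GRing.Theory.
Local Open Scope ring_scope.

Definition is_minimum (S : nat -> Prop) (k : nat) : Prop :=
  S k /\ forall j, S j -> (k <= j)%N.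

Definition ideal_gen (R : comNzRingType) (gs : seq R) (f : R) : Prop :=
  exists a : nat -> R, f = \sum_(i < size gs) a i * gs`_i.

(* The affine plane over F; a point P has abscissa P ord0, ordinate P ord_max. *)
Notation plane F := {ffun 'I_2 -> F}.

Definition pX (F : finFieldType) : {mpoly F[2]} := 'X_ord0.
Definition pY (F : finFieldType) : {mpoly F[2]} := 'X_ord_max.
Arguments pX {F}.
Arguments pY {F}.

Definition hermitian_poly (F : finFieldType) (q : nat) : {mpoly F[2]} :=
  pX ^+ q.+1 - pY ^+ q - pY.

Definition hermitian_points (F : finFieldType) (q : nat) : {set plane F} :=
  [set P : plane F | (hermitian_poly F q).@[P] == 0].

Definition ideal_E (F : finFieldType) (q : nat) : {mpoly F[2]} -> Prop :=
  ideal_gen [:: hermitian_poly F q; pX ^+ (q ^ 2) - pX; pY ^+ (q ^ 2) - pY].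

Definition weight (q : nat) (u : 'X_{1..2}) : nat :=
  (u ord0 * q + u ord_max * q.+1)%N.

(* Elements of the quotient ring A_E are handled through representatives:
   [V_space q m f] says that the class of f modulo [ideal_E F q] lies in the
   span of the classes of the monomials of weight at most m. *)
Definition V_space (F : finFieldType) (q m : nat) (f : {mpoly F[2]}) : Prop :=
  exists2 g : {mpoly F[2]},
    {in msupp g, forall u, (weight q u <= m)%N} & ideal_E q (f - g).

Definition evaluation (F : finFieldType) (E : {set plane F})
    (f : {mpoly F[2]}) : 'rV[F]_#|E| :=
  \row_i f.@[(enum_val i : plane F)].

Definition dual_code (F : finFieldType) (n : nat) (S : 'rV[F]_n -> Prop)
    (c : 'rV[F]_n) : Prop :=
  forall v, S v -> \sum_i c 0 i * v 0 i = 0.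

Definition hermitian_code (F : finFieldType) (q m : nat) :
    'rV[F]_#|hermitian_points F q| -> Prop :=
  dual_code (fun v => exists2 f : {mpoly F[2]},
    V_space q m f & v = evaluation (hermitian_points F q) f).

Definition hamming_weight (F : finFieldType) (n : nat) (c : 'rV[F]_n) : nat :=
  #|[set i | c 0 i != 0]|.

Definition is_distance (F : finFieldType) (n : nat) (C : 'rV[F]_n -> Prop) :
    nat -> Prop :=
  is_minimum (fun w => exists c, [/\ C c, c != 0 & hamming_weight c = w]).

Definition support_points (F : finFieldType) (E : {set plane F})
    (c : 'rV[F]_#|E|) : {set plane F} :=
  [set enum_val i | i in [set i | c 0 i != 0]].

Definition min_weight_support (F : finFieldType) (q m : nat)
    (D : {set plane F}) : Prop :=
  exists c : 'rV[F]_#|hermitian_points F q|,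
    [/\ @hermitian_code F q m c, c != 0,
        is_distance (@hermitian_code F q m) (hamming_weight c)
      & D = support_points c].

Definition monomial_basis (q : nat) (u : 'X_{1..2}) : Prop :=
  ((u ord0 <= q)%N /\ (u ord_max <= q ^ 2 - q - 1)%N) \/
  (u ord0 = 0%N /\ (q ^ 2 - q <= u ord_max <= q ^ 2 - 1)%N).

Definition Lambda_B (q k : nat) : Prop :=
  exists2 u, monomial_basis q u & k = weight q u.

Definition Lambda (q k : nat) : Prop :=
  exists a b : nat, k = (a * q + b * q.+1)%N.

(* m - q^2 + q + 2, reordered so that the truncated subtraction is exact as
   soon as q^2 - q - 2 <= m. *)
Definition delta (q m : nat) : nat := (m + q + 2 - q ^ 2)%N.

Definition is_tilde (q m : nat) : nat -> Prop :=
  is_minimum (fun m' => [/\ (m <= m')%N, Lambda_B q m'.+1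
                          & Lambda q (delta q m')]).

Definition cut_by (F : finFieldType) (q : nat) (D : {set plane F})
    (G : {mpoly F[2]}) : Prop :=
  forall f : {mpoly F[2]},
    (forall P, P \in D -> f.@[P] = 0) <-> ideal_gen [:: hermitian_poly F q; G] f.

(* [msize] is one more than the total degree, so each factor has degree 1. *)
Definition union_of_lines (F : finFieldType) (G : {mpoly F[2]}) : Prop :=
  exists2 ls : seq {mpoly F[2]},
    {in ls, forall l, msize l = 2%N} & G = \prod_(l <- ls) l.

(* Main.v *)
Require Import Defs.
From mathcomp Require Import all_boot all_order all_algebra all_field.
From mathcomp Require Import mpoly.
From mathcomp Require Import zify ring.

Set Implicit Arguments.
Unset Strict Implicit.
Unset Printing Implicit Defensive.

Import GRing.Theory.

(** Write L for the semigroup generated by q and q + 1; its largest gap is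
    q * (q - 1) - 1.  Let t = delta q m and let d be the least element of L that
    is at least t.  The distance is d, by two independent bounds.

    A word c acts on polynomials by f |-> sum_P c_P f(P), and it lies in the
    code exactly when this functional kills all monomials of weight at most m
    ([hermitian_codeP]).  On the curve, monomials of equal weight agree up to
    monomials of smaller weight, since x^(q+1) = y^q + y ([pairing_weight]).

    Lower bound.  Let c be a nonzero word of the code, and k > m the least weight
    of a monomial that c does not kill.  For every factorization k = i + (k - i)
    inside L, pair a monomial of weight i with one of weight k - j: the matrix of
    these values is triangular with nonzero diagonal, and it factors through the
    support of c, so the support has at least as many points as k has such
    factorizations ([rank_bound]).  By the symmetry i |-> q * (q - 1) - 1 - i
    between L and its gaps, that number is t' + g for t' = k + 1 - q * (q - 1),
    where g counts the ways of writing k as a sum of two gaps.  If t' is a gap,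
    the gaps t' + i (q + 1) provide enough such sums to reach the next element of
    L ([factorizations_ge]).  As t' >= t, the support has at least d points.

    Upper bound.  Write d = u q + v (q + 1), and take u lines X = x with x of norm
    different from 1 and v lines Y = y with y of trace 1.  Each of the former
    meets the curve in q points, each of the latter in q + 1, and no two of them
    meet on the curve, so the union D of these intersections has d points
    ([exists_lines]).  A functional on D that kills the monomials with weight in
    L but not in d + L, up to weight d + q * (q - 1) - 2, kills all monomials up
    to that weight, because the product of the lines vanishes on D and has
    leading monomial x^u y^v of weight d.  These are fewer than d conditions
    ([card_footprint]), so a nonzero functional exists ([dual_word_on_lines]).
    It is a word of the code supported in D, and by the lower bound its support
    is all of D.

    Finally D is cut by the product of the lines: a polynomial vanishing on D is
    divided by one line at a time.  On a line, the equation of the curve becomes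
    a univariate polynomial with simple roots, so it divides, on that line, any
    polynomial that vanishes at these roots ([split_good_line], [lines_cut]). *)

(** * The semigroup generated by q and q + 1 *)

(** Division by q gives a boolean form of [Lambda]: a q + b (q + 1) has quotient
    at least a + b and remainder at most b. *)
Definition in_semigroup (q k : nat) : bool := k %% q <= k %/ q.

Section Semigroup.
Variable q : nat.
Hypothesis q_gt0 : 0 < q.

Lemma in_semigroupE a b : b < q -> in_semigroup q (a * q + b) = (b <= a).
Proof.
by move=> bq; rewrite /in_semigroup modnMDl divnMDl // modn_small // divn_small // addn0.
Qed.

Lemma in_semigroup_weight i : in_semigroup q i ->
  (i %/ q - i %% q) * q + i %% q * q.+1 = i.
Proof.
by rewrite /in_semigroup => le_i; rewrite mulnS addnCA addnC -mulnDl subnK // -divn_eq.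
Qed.

Lemma LambdaP k : Lambda q k <-> in_semigroup q k.
Proof.
split=> [[a [b ->]]|le_k].
  rewrite mulnS addnCA addnC -mulnDl /in_semigroup modnMDl divnMDl //.
  by rewrite (leq_trans (leq_mod _ _)) // -addnA addnCA leq_addr.
by exists (k %/ q - k %% q), (k %% q); rewrite in_semigroup_weight.
Qed.

Lemma in_semigroupD i j : in_semigroup q i -> in_semigroup q j -> in_semigroup q (i + j).
Proof.
move=> /LambdaP[a [b ->]] /LambdaP[c [d ->]]; apply/LambdaP; exists (a + c), (b + d).
by rewrite !mulnDl addnACA.
Qed.

(** With i = a q + b the reflected number is (q - 2 - a) q + (q - 1 - b), and
    q - 1 - b <= q - 2 - a holds exactly when b <= a fails. *)
Lemma in_semigroup_sym i : i < q * q.-1 ->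
  in_semigroup q (q * q.-1 - i.+1) = ~~ in_semigroup q i.
Proof.
move=> lti; rewrite {2}(divn_eq i q) in_semigroupE ?ltn_pmod // -ltnNge.
have a_lt : i %/ q < q.-1 by rewrite ltn_divLR // mulnC.
have b_lt := ltn_pmod i q_gt0.
have -> : q * q.-1 - i.+1 = (q.-1 - (i %/ q).+1) * q + (q.-1 - i %% q).
  by have := divn_eq i q; nia.
by rewrite in_semigroupE; lia.
Qed.

Lemma in_semigroup_large i : q * q.-1 <= i -> in_semigroup q i.
Proof.
move=> le_i; apply: leq_trans (_ : q.-1 <= _); first by have := ltn_pmod i q_gt0; lia.
by rewrite leq_divRL // mulnC.
Qed.

(** By the symmetry exactly half of the numbers below q * (q - 1) are in the
    semigroup, and all numbers from there on are.  Doubling avoids the division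
    by 2 in the number of gaps. *)
Lemma sum_in_semigroup t :
  (\sum_(0 <= i < t + q * q.-1) in_semigroup q i).*2 = t.*2 + q * q.-1.
Proof.
rewrite (big_cat_nat (leq0n _) (leq_addl t _)) /= doubleD addnC.
have -> : \sum_(q * q.-1 <= i < t + q * q.-1) in_semigroup q i = t.
  rewrite (eq_big_nat _ _ (F2 := fun=> 1)); last by move=> i /andP[/in_semigroup_large->].
  by rewrite sum_nat_const_nat muln1 addnK.
congr (_ + _); rewrite -addnn {1}big_nat_rev -big_split /=.
rewrite (eq_big_nat _ _ (F2 := fun=> 1)) ?sum_nat_const_nat ?subn0 ?muln1 //.
by move=> i /andP[_ lti]; rewrite add0n in_semigroup_sym //; case: in_semigroup.
Qed.

Definition is_next (t d : nat) :=
  [/\ in_semigroup q d, t <= d & forall j, in_semigroup q j -> t <= j -> d <= j].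

Lemma exists_next t : exists d, is_next t d.
Proof.
have ex : exists k, in_semigroup q k && (t <= k).
  by exists (q * q.-1 + t); rewrite in_semigroup_large ?leq_addr ?leq_addl.
exists (ex_minn ex); case: ex_minnP => d /andP[Ld td] dmin; split=> // j Lj tj.
by apply: dmin; rewrite Lj.
Qed.

Lemma card_ord_pred n (b : pred nat) : #|[set i : 'I_n | b i]| = \sum_(0 <= i < n) b i.
Proof. by rewrite -sum1dep_card big_mkcond big_mkord. Qed.

(** Inclusion and exclusion: as sets of i, those with i a gap and those with
    n - 1 - i a gap have the same size, half of q * (q - 1). *)
Lemma sum_factorizations t : 0 < t ->
  \sum_(0 <= i < t + q * q.-1) (in_semigroup q i && in_semigroup q (t + q * q.-1 - i.+1)) =
  t + \sum_(0 <= i < t + q * q.-1)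
        (~~ in_semigroup q i && ~~ in_semigroup q (t + q * q.-1 - i.+1)).
Proof.
move=> t_gt0; set n := t + _.
have N := sum_in_semigroup t; rewrite -/n in N.
have M : \sum_(0 <= i < n) in_semigroup q (n - i.+1) = \sum_(0 <= i < n) in_semigroup q i.
  by rewrite [RHS]big_nat_rev; apply: eq_big_nat => i _; rewrite add0n.
have : \sum_(0 <= i < n) (in_semigroup q i && in_semigroup q (n - i.+1)) + n =
       \sum_(0 <= i < n) in_semigroup q i + \sum_(0 <= i < n) in_semigroup q (n - i.+1) +
       \sum_(0 <= i < n) (~~ in_semigroup q i && ~~ in_semigroup q (n - i.+1)).
  rewrite -[X in _ + X = _](_ : \sum_(0 <= i < n) 1 = n); last first.
    by rewrite sum_nat_const_nat subn0 muln1.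
  rewrite -!big_split /=; apply: eq_bigr => i _.
  by case: in_semigroup; case: in_semigroup.
rewrite M; lia.
Qed.

(** The witnesses are t + i (q + 1) for i < q - b, where b is the remainder of t:
    each step raises quotient and remainder by one, so the number remains a gap
    as long as its remainder stays below q.  The complementary number
    (q - 2 - i) q + (q - 1 - i) is a gap as well. *)
Lemma gap_pairs_ge t : 0 < t -> ~~ in_semigroup q t ->
  q - t %% q <= \sum_(0 <= i < t + q * q.-1)
        (~~ in_semigroup q i && ~~ in_semigroup q (t + q * q.-1 - i.+1)).
Proof.
move=> t_gt0 nLt; rewrite -(card_ord_pred _ (fun i => _ && _)).
set n := t + q * q.-1; set b := t %% q; set a := t %/ q.
have b_lt : b < q by rewrite ltn_pmod.
have ab : a < b by move: nLt; rewrite /in_semigroup -ltnNge.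
have te : t = a * q + b by rewrite [LHS](divn_eq t q).
have lt_n (i : 'I_(q - b)) : t + i * q.+1 < n.
  by rewrite ltn_add2l; have := ltn_ord i; nia.
pose f i := Ordinal (lt_n i).
have f_inj : injective f by move=> i j /(congr1 val) /= E; apply: val_inj => /=; nia.
rewrite -[leqLHS]card_ord -(card_imset _ f_inj).
apply/subset_leq_card/subsetP=> _ /imsetP[i _ ->].
have lti := ltn_ord i; rewrite inE /=; apply/andP; split.
  have -> : t + i * q.+1 = (a + i) * q + (b + i) by nia.
  by rewrite in_semigroupE; lia.
have -> : n - (t + i * q.+1).+1 = (q.-1 - i.+1) * q + (q.-1 - i) by rewrite /n; nia.
by rewrite in_semigroupE; lia.
Qed.

(** When t is a gap, t + (q - t %% q) is the next multiple of q, which is in the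
    semigroup. *)
Lemma factorizations_ge t d : 0 < t -> is_next t d ->
  d <= #|[set i : 'I_(t + q * q.-1) |
           in_semigroup q i && in_semigroup q (t + q * q.-1 - i.+1)]|.
Proof.
move=> t_gt0 [Ld td dmin].
rewrite (card_ord_pred _ (fun i => in_semigroup q i && in_semigroup q (_ - i.+1))).
rewrite sum_factorizations //.
have [Lt|nLt] := boolP (in_semigroup q t).
  by rewrite (leq_trans (dmin _ Lt _)) ?leq_addr.
apply: leq_trans (leq_add (leqnn t) (gap_pairs_ge t_gt0 nLt)).
apply: dmin; last exact: leq_addr.
have b_lt := ltn_pmod t q_gt0.
have -> : t + (q - t %% q) = (t %/ q).+1 * q + 0 by have := divn_eq t q; nia.
by rewrite in_semigroupE.
Qed.

Lemma next_mono t t' d d' : t <= t' -> is_next t d -> is_next t' d' -> d <= d'.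
Proof. by move=> tt' [_ _ dmin] [Ld' td' _]; apply: dmin => //; apply: leq_trans td'. Qed.

(** The weights of a monomial basis of the quotient of the coordinate ring by an
    element of weight d. *)
Definition footprint (d k : nat) :=
  in_semigroup q k && ~~ ((d <= k) && in_semigroup q (k - d)).

(** Up to d + q * (q - 1) - 1 the footprint has exactly d elements, and that last
    number is one of them, since subtracting d from it gives the largest gap. *)
Lemma card_footprint d : 0 < d -> in_semigroup q d ->
  #|[set i : 'I_(d + q * q.-1).-1 | footprint d i]| < d.
Proof.
move=> d_gt0 Ld; rewrite (card_ord_pred _ (footprint d)).
have Hn : 0 < d + q * q.-1 by rewrite addn_gt0 d_gt0.
have H1 : \sum_(0 <= i < d + q * q.-1) footprint d i +
    \sum_(0 <= i < q * q.-1) in_semigroup q i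
  = \sum_(0 <= i < d + q * q.-1) in_semigroup q i.
  have -> : \sum_(0 <= i < q * q.-1) in_semigroup q i =
     \sum_(0 <= i < d + q * q.-1) ((d <= i) && in_semigroup q (i - d)).
    rewrite [RHS](big_cat_nat (leq0n d) (leq_addr _ _)) /=.
    rewrite [X in _ = X + _]big_nat_cond [X in _ = X + _]big1 => [|i]; last first.
      by case/andP=> /andP[_ lti] _; rewrite leqNgt lti.
    have := big_addn 0 (d + q * q.-1) d xpredT; rewrite /= !add0n => ->.
    by rewrite addKn; apply: eq_bigr => i _; rewrite leq_addl addnK.
  rewrite -big_split; apply: eq_bigr => i _; rewrite /footprint /=.
  case: (boolP (d <= i)) => di /=; last by rewrite andbT addn0.
  have [Li|] := boolP (in_semigroup q (i - d)); last by rewrite andbT addn0.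
  by rewrite andbF -(subnK di) addnC in_semigroupD.
have S0 := sum_in_semigroup 0; rewrite add0n in S0; have Sd := sum_in_semigroup d.
suff S1 : \sum_(0 <= i < d + q * q.-1) footprint d i =
         (\sum_(0 <= i < (d + q * q.-1).-1) footprint d i).+1 by lia.
rewrite -{1}(prednK Hn) big_nat_recr //= -addn1; congr (_ + _).
rewrite /footprint in_semigroup_large; last by rewrite -ltnS prednK //; lia.
case: leqP => //= di; case: (posnP (q * q.-1)) => [|W]; first by lia.
have -> : (d + q * q.-1).-1 - d = q * q.-1 - 1 by lia.
by rewrite in_semigroup_sym //= /in_semigroup mod0n div0n.
Qed.

End Semigroup.

(** * Trace and norm from the field with q ^ 2 elements *)

(** If the fibres have at most k elements but the source has at least k times as
    many elements as the target, then every fibre is full. *)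
Lemma fibre_card (A B : finType) (f : A -> B) (SA : {set A}) (SB : {set B}) k :
  {in SA, forall a, f a \in SB} ->
  {in SB, forall b, #|[set a in SA | f a == b]| <= k} -> k * #|SB| <= #|SA| ->
  {in SB, forall b, #|[set a in SA | f a == b]| = k}.
Proof.
move=> fS le_k le_card b Sb; apply/eqP; rewrite eqn_leq le_k //= leqNgt.
apply: contraL le_card => lt_k; rewrite -ltnNge -(sum1_card (mem SA)).
rewrite (partition_big f (mem SB)) //= (bigD1 b) //= (cardsD1 b) Sb mulnDr muln1.
rewrite mulnC -addSn leq_add //; first by rewrite sum1dep_card.
rewrite -sum_nat_const big_mkcond [leqRHS]big_mkcond leq_sum // => i _.
rewrite !inE andbC; case: ifP => // /andP[_ Si]; rewrite sum1dep_card.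
exact: le_k.
Qed.

Local Open Scope ring_scope.

Section Field.
Variables (F : finFieldType) (p e q : nat).
Hypotheses (p_prime : prime p) (e_gt0 : (0 < e)%N) (q_def : q = (p ^ e)%N).
Hypothesis cardF : #|F| = (q ^ 2)%N.

Lemma q_gt1 : (1 < q)%N.
Proof. by rewrite q_def -(expn0 p) ltn_exp2l ?prime_gt1. Qed.

Lemma card_roots (h : {poly F}) : h != 0 -> (#|[set y | root h y]| <= (size h).-1)%N.
Proof.
move=> h0; have : (#|[set y | root h y]| < size h)%N.
  rewrite cardE; apply: max_poly_roots => //; last exact: enum_uniq.
  by apply/allP=> y; rewrite mem_enum inE.
by case: size.
Qed.

Lemma expqq (x : F) : x ^+ q ^+ q = x.
Proof. by rewrite -exprM mulnn -cardF expf_card. Qed.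

Lemma exprqD (x y : F) : (x + y) ^+ q = x ^+ q + y ^+ q.
Proof.
apply: exprDn_pchar; rewrite q_def.
have pF : p \in [pchar F].
  by apply: (@card_finPcharP _ p (e * 2)) => //; rewrite cardF q_def expnM.
by rewrite (eq_pnat _ (pcharf_eq pF)) pnatX pnat_id.
Qed.

Definition frob_fixed : {set F} := [set z | z ^+ q == z].

Lemma card_frob_fixed : (#|frob_fixed| <= q)%N.
Proof.
have sz : size ('X^q - 'X : {poly F}) = q.+1.
  by rewrite size_polyDl ?size_polyXn // size_polyN size_polyX ltnS q_gt1.
have := @card_roots ('X^q - 'X).
rewrite sz -size_poly_gt0 sz => /(_ isT); congr (_ <= _)%N.
by apply: eq_card => z; rewrite !inE rootE !hornerE subr_eq0.
Qed.

(** The equation of the curve on a vertical line of abscissa x, with z = x^(q+1);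
    the sign is that of [hermitian_poly]. *)
Definition trace_poly (z : F) : {poly F} := (z%:P - ('X^q + 'X))%R.

Lemma size_trace_poly z : size (trace_poly z) = q.+1.
Proof.
have s1 : size ('X^q + 'X : {poly F}) = q.+1.
  by rewrite size_polyDl ?size_polyXn // size_polyX ltnS q_gt1.
rewrite /trace_poly addrC size_polyDl size_polyN s1 // ltnS.
exact: leq_trans (size_polyC_leq1 _) (ltnW q_gt1).
Qed.

Lemma root_trace_poly z y : root (trace_poly z) y = (y ^+ q + y == z).
Proof. by rewrite rootE /trace_poly !hornerE subr_eq0 eq_sym. Qed.

(** The trace maps q ^ 2 elements to at most q values, with fibres of size at
    most q by the degree of [trace_poly]. *)
Lemma card_trace_fibre z : z \in frob_fixed -> #|[set y | root (trace_poly z) y]| = q.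
Proof.
move=> Sz; have tS y : y ^+ q + y \in frob_fixed.
  by rewrite inE exprqD expqq addrC.
rewrite -(@fibre_card _ _ (fun y => y ^+ q + y) setT frob_fixed q _ _ _ z Sz) //.
- by apply: eq_card => y; rewrite !inE root_trace_poly.
- move=> b _; have := @card_roots (trace_poly b).
  rewrite -size_poly_gt0 size_trace_poly => /(_ isT); congr (_ <= _)%N.
  by apply: eq_card => y; rewrite !inE root_trace_poly.
- by rewrite cardsT cardF -mulnn leq_mul2l card_frob_fixed orbT.
Qed.

Definition norm_poly (z : F) : {poly F} := 'X^(q.+1) - z%:P.

Lemma size_norm_poly z : size (norm_poly z) = q.+2.
Proof.
by rewrite size_polyDl size_polyXn // size_polyN ltnS (leq_trans (size_polyC_leq1 _)).
Qed.

Lemma root_norm_poly z y : root (norm_poly z) y = (y ^+ q.+1 == z).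
Proof. by rewrite rootE /norm_poly !hornerE subr_eq0. Qed.

Lemma norm_frob_fixed x : x ^+ q.+1 \in frob_fixed.
Proof. by rewrite inE -exprM mulSn exprD exprM exprSr -exprM mulnn -cardF expf_card mulrC. Qed.

(** The norm maps q ^ 2 - 1 nonzero elements to at most q - 1 nonzero values,
    with fibres of size at most q + 1. *)
Lemma card_norm1 : #|[set y | root (norm_poly 1) y]| = q.+1.
Proof.
have S1 : (1 : F) \in frob_fixed :\ 0 by rewrite !inE expr1n eqxx oner_eq0.
rewrite -(@fibre_card _ _ (fun y => y ^+ q.+1) [set~ 0] (frob_fixed :\ 0) q.+1 _ _ _ 1 S1) //.
- apply: eq_card => y; rewrite !inE root_norm_poly andbC.
  by case: eqP => // y1; apply/esym/eqP=> y0; move/eqP: y1; rewrite y0 expr0n eq_sym oner_eq0.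
- by move=> x; rewrite inE in_set1 => x0; rewrite in_setD1 norm_frob_fixed expf_neq0.
- move=> b _; have := @card_roots (norm_poly b).
  rewrite -size_poly_gt0 size_norm_poly => /(_ isT); apply: leq_trans; apply: subset_leq_card.
  by apply/subsetP=> y; rewrite !inE root_norm_poly => /andP[].
- have : (#|frob_fixed| <= q)%N by exact: card_frob_fixed.
  rewrite (cardsD1 0) inE expr0n -(prednK (ltnW q_gt1)) eqxx /= prednK ?(ltnW q_gt1) //.
  have := cardsC1 (0 : F); rewrite cardF => ->.
  move=> le_c; apply: leq_trans (leq_mul (leqnn _) (_ : _ <= q.-1)%N) _.
    by rewrite -ltnS prednK ?(ltnW q_gt1).
  by have := q_gt1; rewrite -mulnn; nia.
Qed.

End Field.

(** * Functionals on the points of the curve *)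

Lemma rank_zero_cols (F : fieldType) m n (M : 'M[F]_(m, n)) (S : {set 'I_n}) :
  (forall i j, j \notin S -> M i j = 0) -> (\rank M <= #|S|)%N.
Proof.
move=> M0; have -> : M = colsub (@enum_val _ (mem S)) M *m rowsub (@enum_val _ (mem S)) 1%:M.
  apply/matrixP=> i j; rewrite !mxE.
  under eq_bigr do rewrite !mxE.
  rewrite -(big_enum_val (fun k => M i k * (k == j)%:R)) /=.
  have [Sj|nSj] := boolP (j \in S).
    rewrite (bigD1 j) //= eqxx mulr1 big1 ?addr0 // => k /andP[_ /negPf->].
    by rewrite mulr0.
  by rewrite M0 // big1 // => k Sk; rewrite (negPf (memPn nSj k Sk)) mulr0.
exact: mulmx_max_rank.
Qed.

(** Adding ones on the diagonal outside S makes M invertible and raises the rank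
    by at most the size of the complement of S. *)
Lemma rank_trig_ge (F : fieldType) n (M : 'M[F]_n) (S : {set 'I_n}) :
  (forall i j : 'I_n, (i < j)%N -> M i j = 0) ->
  (forall i j, i \notin S -> M i j = 0) -> {in S, forall i, M i i != 0} ->
  (#|S| <= \rank M)%N.
Proof.
move=> Mt M0 Md; pose D : 'M[F]_n := diag_mx (\row_i (i \notin S)%:R).
have rD : (\rank D <= #|~: S|)%N.
  apply: rank_zero_cols => i j; rewrite inE negbK => Sj; rewrite !mxE.
  by case: eqP => [->|//]; rewrite Sj.
have rMD : \rank (M + D)%R = n.
  apply: mxrank_unit; rewrite unitmxE unitfE det_trig.
    apply/prodf_neq0 => i _; rewrite !mxE eqxx mulr1n.
    by have [Si|nSi] := boolP (i \in S); rewrite ?addr0 ?Md // M0 // add0r oner_neq0.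
  apply/is_trig_mxP=> i j lt_ij; rewrite !mxE Mt // add0r.
  by case: eqP => // E; rewrite E ltnn in lt_ij.
have := leq_trans (mxrank_add M D) (leq_add (leqnn _) rD).
by rewrite rMD -[X in (X <= _)%N](card_ord n) -(cardsC S) leq_add2r.
Qed.

Section Pairing.
Variables (F : finFieldType) (q : nat).
Hypothesis q_gt1 : (1 < q)%N.
Local Notation E := (hermitian_points F q).

Definition xy a b : {mpoly F[2]} := pX ^+ a * pY ^+ b.

Lemma xyM a b c d : xy a b * xy c d = xy (a + c) (b + d).
Proof. by rewrite /xy !exprD mulrACA. Qed.

Lemma ord2_cases (k : 'I_2) : (k == ord0) || (k == ord_max).
Proof. by case: k => -[|[|]]. Qed.

Lemma ord2_other (i j k : 'I_2) : i != j -> k != i -> k = j.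
Proof.
by move=> ij ki; case/orP: (ord2_cases k) (ord2_cases i) (ord2_cases j) ki ij
  => /eqP-> /orP[]/eqP-> /orP[]/eqP->.
Qed.

Lemma mpolyX_xy u : 'X_[u] = xy (u ord0) (u ord_max).
Proof.
rewrite mpolyXE_id big_ord_recl big_ord1 /xy /pX /pY.
by have -> : lift ord0 ord0 = ord_max :> 'I_2 by apply: val_inj.
Qed.

Lemma meval_xy P a b : (xy a b).@[P] = P ord0 ^+ a * P ord_max ^+ b.
Proof. by rewrite mevalM !rmorphXn /= !mevalXU. Qed.

Lemma mem_hermitian_points P : (P \in E) = (P ord0 ^+ q.+1 == P ord_max ^+ q + P ord_max).
Proof.
by rewrite inE !mevalB !rmorphXn /= !mevalXU -addrA -opprD subr_eq0.
Qed.

Definition pairing (c : plane F -> F) (f : {mpoly F[2]}) := \sum_P c P * f.@[P].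

Lemma pairingD c f g : pairing c (f + g) = pairing c f + pairing c g.
Proof. by rewrite -big_split; apply: eq_bigr => P _; rewrite mevalD mulrDr. Qed.

Lemma pairingZ c a f : pairing c (a *: f) = a * pairing c f.
Proof. by rewrite mulr_sumr; apply: eq_bigr => P _; rewrite mevalZ mulrCA. Qed.

Lemma pairing0 c : pairing c 0 = 0.
Proof. by apply: big1 => P _; rewrite meval0 mulr0. Qed.

(** Words are handled as functions on the whole plane, so that sums over the
    coordinates become sums over all points. *)
Definition supported_on_curve (c : plane F -> F) := forall P, P \notin E -> c P = 0.

Definition vanish_below (c : plane F -> F) k :=
  forall a b, (a * q + b * q.+1 < k)%N -> pairing c (xy a b) = 0.

Lemma pairing_step c k (a b : nat) : supported_on_curve c -> vanish_below c k ->
  ((a + q.+1) * q + b * q.+1 = k)%N ->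
  pairing c (xy (a + q.+1) b) = pairing c (xy a (b + q)).
Proof.
move=> cE cv ek; rewrite -[RHS]addr0 -(cv a b.+1); last by rewrite -ek; lia.
rewrite -pairingD; apply: eq_bigr => P _.
have [|/cE->] := boolP (P \in E); last by rewrite !mul0r.
rewrite mem_hermitian_points mevalD !meval_xy => /eqP EP; congr (_ * _).
by rewrite exprD EP exprD exprS; ring.
Qed.

(** Since q and q + 1 are coprime, two monomials of the same weight differ by
    replacing x^(q+1) with y^q several times, and on the curve each replacement
    costs only a term of lower weight. *)
Lemma pairing_weight c k (a b a' b' : nat) : supported_on_curve c -> vanish_below c k ->
  (a * q + b * q.+1 = k)%N -> (a' * q + b' * q.+1 = k)%N ->
  pairing c (xy a b) = pairing c (xy a' b').
Proof.
move=> cE cv; wlog le_a : a b a' b' / (a' <= a)%N.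
  by move=> W ek ek'; case: (leqP a' a) => [|/ltnW] le_a; [|symmetry]; exact: W.
elim: {a}(a - a')%N {-2}a (leqnn (a - a')) b le_a => [|n IHn] a le_n b le_a ek ek'.
  have -> : a = a' by lia.
  by congr (pairing _ (xy _ _)); nia.
have [ea|lt_a] := eqVneq a a'.
  by rewrite ea; congr (pairing _ (xy _ _)); nia.
have q1_dvd : (q.+1 %| a - a')%N.
  rewrite -(@Gauss_dvdl q.+1 _ q); last exact: coprimeSn.
  by apply/dvdnP; exists (b' - b)%N; nia.
have le_q : (q.+1 <= a - a')%N by apply: dvdn_leq => //; lia.
have ea : a = (a - q.+1 + q.+1)%N by lia.
have := @pairing_step c k (a - q.+1)%N b cE cv; rewrite -ea => /(_ ek) ->.
by apply: IHn => //; nia.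
Qed.

Definition extension (D : {set plane F}) (v : 'rV[F]_#|D|) (P : plane F) : F :=
  \sum_(i < #|D|) v 0 i * (enum_val i == P)%:R.

Lemma extension_val (D : {set plane F}) (v : 'rV_#|D|) i : extension v (enum_val i) = v 0 i.
Proof.
rewrite /extension (bigD1 i) //= eqxx mulr1 big1 ?addr0 // => j ji.
by rewrite (inj_eq enum_val_inj) (negPf ji) mulr0.
Qed.

Lemma extension_out (D : {set plane F}) (v : 'rV_#|D|) P : P \notin D -> extension v P = 0.
Proof.
move=> nD; apply: big1 => i _; case: eqP => [iP|_]; last by rewrite mulr0.
by rewrite -iP enum_valP in nD.
Qed.

Lemma pairing_extension (D : {set plane F}) (v : 'rV_#|D|) f :
  pairing (extension v) f = \sum_i v 0 i * f.@[(enum_val i : plane F)].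
Proof.
rewrite /pairing (bigID (mem D)) /= [X in _ + X]big1 ?addr0; last first.
  by move=> P nD; rewrite extension_out ?mul0r.
by rewrite big_enum_val; apply: eq_bigr => i _; rewrite extension_val.
Qed.

Lemma interpolation (P : plane F) : exists f : {mpoly F[2]},
  f.@[P] != 0 /\ forall Q, Q != P -> f.@[Q] = 0.
Proof.
pose i (Q : plane F) : 'I_2 := if Q ord0 != P ord0 then ord0 else ord_max.
exists (\prod_(Q | Q != P) ('X_(i Q) - (Q (i Q))%:MP)); split.
  rewrite rmorph_prod; apply/prodf_neq0 => Q neQP /=.
  rewrite mevalB mevalXU mevalC subr_eq0 /i; case: ifP => [|/negbT]; first by rewrite eq_sym.
  rewrite negbK => /eqP E0; apply: contraNneq neQP => E1; apply/eqP/ffunP=> k.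
  by case/orP: (ord2_cases k) => /eqP->.
move=> Q neQP; rewrite rmorph_prod (bigD1 Q) //= mevalB mevalXU mevalC subrr.
by rewrite mul0r.
Qed.

(** Point evaluations are linearly independent on polynomials, by
    interpolation. *)
Lemma pairing_eq0 c : (forall a b, pairing c (xy a b) = 0) -> forall P, c P = 0.
Proof.
move=> c0 P; have cf0 f : pairing c f = 0.
  elim/mpolyind: f => [|a u f _ _ IHf]; first exact: pairing0.
  by rewrite pairingD pairingZ mpolyX_xy c0 mulr0 IHf addr0.
have [f [fP f0]] := interpolation P; have := cf0 f.
rewrite /pairing (bigD1 P) //= big1 => [|Q neQP]; last by rewrite f0 ?mulr0.
by rewrite addr0 => /eqP; rewrite mulf_eq0 (negPf fP) orbF => /eqP.
Qed.

(** The entry (i, j) of A *m B is the value of c on a product of monomials of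
    weights i and k - j: zero below weight k, and nonzero at weight k by
    [pairing_weight].  The inner dimension runs through the points of the plane,
    and only those where c is nonzero contribute to the rank. *)
Lemma rank_bound c k (a b : nat) : supported_on_curve c -> vanish_below c k ->
  (a * q + b * q.+1 = k)%N -> pairing c (xy a b) != 0 ->
  (#|[set i : 'I_k.+1 | in_semigroup q i && in_semigroup q (k - i)]|
   <= #|[set P | c P != 0%R]|)%N.
Proof.
move=> cE cv ek nz; set S := [set i : 'I_k.+1 | _].
pose mon i := xy (i %/ q - i %% q) (i %% q).
pose pt (j : 'I_#|plane F|) : plane F := enum_val j.
pose A : 'M[F]_(k.+1, #|plane F|) :=
  \matrix_(i, j) ((i \in S)%:R * (c (pt j) * (mon i).@[pt j])).
pose B : 'M[F]_(#|plane F|, k.+1) :=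
  \matrix_(j, i) ((i \in S)%:R * (mon (k - i)%N).@[pt j]).
have ABE i j : (A *m B) i j =
    (i \in S)%:R * ((j \in S)%:R * pairing c (mon i * mon (k - j)%N)).
  rewrite mxE /pairing !mulr_sumr [RHS](reindex pt) /=; last first.
    by apply: onW_bij; apply: enum_val_bij.
  by apply: eq_bigr => l _; rewrite !mxE (mevalM _ (mon i)); ring.
have S_w (i j : 'I_k.+1) : i \in S -> j \in S ->
    ((i %/ q - i %% q + ((k - j) %/ q - (k - j) %% q)) * q +
    (i %% q + (k - j) %% q) * q.+1 = i + (k - j))%N.
  rewrite !inE => /andP[/in_semigroup_weight wi _] /andP[_ /in_semigroup_weight wj].
  by rewrite !mulnDl addnACA wi wj.
apply: leq_trans (_ : \rank (A *m B) <= _)%N; last first.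
  apply: leq_trans (mxrankM_maxl _ _) _.
  apply: leq_trans (rank_zero_cols (S := [set j | c (pt j) != 0]) _) _.
    by move=> i j; rewrite inE negbK => /eqP c0; rewrite mxE c0 mul0r mulr0.
  rewrite -(card_imset _ enum_val_inj); apply/subset_leq_card/subsetP=> _ /imsetP[j cj ->].
  by move: cj; rewrite !inE.
apply: rank_trig_ge => [i j lt_ij|i j nSi|i Si].
- rewrite ABE; have [Si|_] := boolP (i \in S); last by rewrite mul0r.
  have [Sj|_] := boolP (j \in S); last by rewrite mul0r mulr0.
  by rewrite xyM cv ?mulr0 // S_w //; have := ltn_ord j; lia.
- by rewrite ABE (negPf nSi) mul0r.
- rewrite ABE Si !mul1r xyM (pairing_weight cE cv _ ek) // S_w //.
  by have := ltn_ord i; lia.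
Qed.

(** If the support had fewer than d points, [rank_bound] would propagate the
    vanishing of c from each weight to the next, so that c would kill all
    monomials and be zero. *)
Lemma weight_lower_bound c m d : (q * q.-1 <= m.+1)%N ->
  supported_on_curve c -> vanish_below c m.+1 -> is_next q (m + 2 - q * q.-1) d ->
  (exists P, c P != 0) -> (d <= #|[set P | c P != 0%R]|)%N.
Proof.
move=> le_m cE cv nd [P cP]; rewrite leqNgt; apply: contra_neqN cP => lt_d.
apply: pairing_eq0 => {P} a b; move Ek: (a * q + b * q.+1)%N => k.
elim/ltn_ind: k => k IHk in a b Ek *.
have [lt_k|le_k] := ltnP k m.+1; first by apply: cv; rewrite Ek.
have cvk : vanish_below c k by move=> a' b' lt_k; apply: (IHk _ lt_k).
apply/eqP; apply: contraLR lt_d => nz; rewrite -leqNgt.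
apply: leq_trans (rank_bound cE cvk Ek nz).
have q_gt0 := ltnW q_gt1.
pose t := (k.+1 - q * q.-1)%N; have t_gt0 : (0 < t)%N by rewrite /t; lia.
have [d' nd'] := exists_next q_gt0 t.
have le_d : (d <= d')%N by apply: next_mono nd nd'; rewrite /t; lia.
apply: leq_trans le_d _; have := factorizations_ge q_gt0 t_gt0 nd'.
by rewrite /t subnK //; lia.
Qed.

End Pairing.

(** * Sets of points cut out by lines *)

Section Lines.
Variables (F : finFieldType) (q : nat).
Hypothesis q_gt1 : (1 < q)%N.
Local Notation H := (hermitian_poly F q).
Local Notation E := (hermitian_points F q).

Definition index_weight (i : 'I_2) : nat := if i == ord0 then q else q.+1.

(** The pair (i, x) encodes the line on which the i-th coordinate equals x. *)
Definition line (l : 'I_2 * F) : {mpoly F[2]} := 'X_(l.1) - (l.2)%:MP.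

Definition line_zeros (l : 'I_2 * F) : {set plane F} := [set P in E | P l.1 == l.2].

Definition lines_poly (ls : seq ('I_2 * F)) := \prod_(l <- ls) line l.

Definition lines_weight (ls : seq ('I_2 * F)) := (\sum_(l <- ls) index_weight l.1)%N.

Definition lines_zeros (ls : seq ('I_2 * F)) : {set plane F} :=
  [set P in E | has (fun l => P l.1 == l.2) ls].

Lemma meval_line l P : (line l).@[P] = P l.1 - l.2.
Proof. by rewrite mevalB mevalXU mevalC. Qed.

Lemma meval_lines ls P : ((lines_poly ls).@[P] == 0) = has (fun l => P l.1 == l.2) ls.
Proof.
rewrite /lines_poly; elim: ls => [|l ls IHls] /=.
  by rewrite big_nil meval1 oner_eq0.
by rewrite big_cons mevalM mulf_eq0 IHls meval_line subr_eq0.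
Qed.

(** Transversality: the scheme-theoretic intersection of the line and the curve is
    reduced and consists of rational points. *)
Definition good_line l := #|line_zeros l| = index_weight l.1 /\
  forall f : {mpoly F[2]}, {in line_zeros l, forall P : plane F, f.@[P] = 0} ->
    exists a b, f = a * H + b * line l.

Definition disjoint_lines l l' := [disjoint line_zeros l & line_zeros l'].

Lemma lines_zeros_cons l ls : lines_zeros (l :: ls) = line_zeros l :|: lines_zeros ls.
Proof. by apply/setP=> P; rewrite !inE /= andb_orr. Qed.

Lemma disjoint_lines_zeros l ls : all (disjoint_lines l) ls ->
  [disjoint line_zeros l & lines_zeros ls].
Proof.
move=> /allP dl; apply/pred0P=> P /=; apply/negP=> /andP[Pl].
rewrite inE => /andP[EP /hasP[l' l'ls Pl']].
have /pred0P/(_ P)/= := dl _ l'ls; rewrite Pl /=.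
by rewrite inE EP Pl'.
Qed.

Lemma card_lines_zeros ls : pairwise disjoint_lines ls ->
  {in ls, forall l, good_line l} -> #|lines_zeros ls| = lines_weight ls.
Proof.
rewrite /lines_weight; elim: ls => [|l ls IHls] /=.
  move=> _ _; rewrite big_nil; apply: eq_card0 => P; by rewrite inE andbF.
move=> /andP[/disjoint_lines_zeros dl /IHls{}IHls] good.
rewrite big_cons lines_zeros_cons cardsU (disjoint_setI0 dl) cards0 subn0.
rewrite (proj1 (good l (mem_head _ _))) IHls // => l' l'ls.
by apply: good; rewrite inE l'ls orbT.
Qed.

(** After division by the first line, the cofactor b still vanishes on the other
    lines, because there the first line does not vanish on the curve. *)
Lemma lines_cut ls : pairwise disjoint_lines ls ->
  {in ls, forall l, good_line l} ->
  forall f : {mpoly F[2]}, {in lines_zeros ls, forall P : plane F, f.@[P] = 0} ->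
  exists a b, f = a * H + b * lines_poly ls.
Proof.
rewrite /lines_poly; elim: ls => [|l ls IHls] /=.
  by move=> _ _ f _; exists 0, f; rewrite big_nil mul0r add0r mulr1.
move=> /andP[/disjoint_lines_zeros dl /IHls{}IHls] good f f0.
have [|a [b fE]] := proj2 (good l (mem_head _ _)) f.
  by move=> P Pl; apply: f0; rewrite lines_zeros_cons in_setU Pl.
have [||a' [b' bE]] := IHls _ b.
- by move=> l' l'ls; apply: good; rewrite inE l'ls orbT.
- move=> P Pls; have : f.@[P] = 0 by apply: f0; rewrite lines_zeros_cons in_setU Pls orbT.
  have EP : P \in E by move: Pls; rewrite inE => /andP[].
  have HP : H.@[P] = 0 by move: EP; rewrite inE => /eqP.
  rewrite fE mevalD !mevalM HP mulr0 add0r => /eqP; rewrite mulf_eq0 => /orP[/eqP//|].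
  rewrite meval_line subr_eq0 => Pl; have /pred0P/(_ P)/= := dl.
  by rewrite Pls inE EP Pl.
exists (a + a' * line l), b'; rewrite fE bE big_cons; ring.
Qed.

Lemma lines_weightE ls : lines_weight ls =
  (count (fun l => l.1 == ord0) ls * q + count (fun l => l.1 == ord_max) ls * q.+1)%N.
Proof.
rewrite /lines_weight; elim: ls => [|l ls IH]; first by rewrite big_nil.
rewrite big_cons IH /= /index_weight.
by case/orP: (ord2_cases l.1) => /eqP-> /=; rewrite ?mulnDl ?mul1n; lia.
Qed.

(** Replacing a factor X_i - x by X_i only discards products whose monomials all
    have weight below k. *)
Lemma pairing_lead c k ls (a b : nat) : vanish_below q c k ->
  (a * q + b * q.+1 + lines_weight ls <= k)%N ->
  pairing c (xy F a b * lines_poly ls) =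
  pairing c (xy F (a + count (fun l => l.1 == ord0) ls)
                  (b + count (fun l => l.1 == ord_max) ls)).
Proof.
move=> cv; rewrite /lines_weight /lines_poly; elim: ls => [|l ls IHls] /= in a b *.
  by rewrite !big_nil mulr1 !addn0.
rewrite !big_cons => le_k.
have wt_gt0 : (0 < index_weight l.1)%N.
  by rewrite /index_weight; case: ifP => // _; apply: ltnW.
have low : pairing c (xy F a b * \prod_(l' <- ls) line l') = 0.
  rewrite IHls; last by lia.
  rewrite cv //; apply: leq_trans le_k; rewrite !mulnDl.
  by rewrite -/(lines_weight ls) lines_weightE; lia.
rewrite mulrA mulrBr mulrBl pairingD.
have -> : - (xy F a b * l.2%:MP * \prod_(j <- ls) line j) =
          - l.2 *: (xy F a b * \prod_(j <- ls) line j).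
  by rewrite -mulrA mulrCA mul_mpolyC scaleNr.
rewrite pairingZ low mulr0 addr0.
have [l0|l1] := orP (ord2_cases l.1).
  have -> : xy F a b * 'X_(l.1) = xy F a.+1 b.
    by rewrite (eqP l0) /xy exprSr -/pX mulrAC.
  rewrite IHls /= ?(eqP l0) ?addSnnS //; move: le_k; rewrite /index_weight l0; lia.
have -> : xy F a b * 'X_(l.1) = xy F a b.+1.
  by rewrite (eqP l1) /xy exprSr -/pY mulrA.
rewrite IHls /= ?(eqP l1) ?addSnnS //; move: le_k; rewrite /index_weight (eqP l1) /=; lia.
Qed.

(** The conditions imposed are those for one monomial in each weight of the
    footprint.  A weight outside it is d plus an element of the semigroup, so a
    monomial of that weight is, up to lower weights, a multiple of the product
    of the lines. *)
Lemma dual_word_on_lines ls (d := lines_weight ls) : (0 < d)%N -> #|lines_zeros ls| = d ->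
  exists c : plane F -> F, [/\ exists P, c P != 0,
     forall P, P \notin lines_zeros ls -> c P = 0 &
     vanish_below q c (d + q * q.-1).-1].
Proof.
move=> d_gt0 cardD; set D := lines_zeros ls; set K := (d + q * q.-1).-1.
have q_gt0 := ltnW q_gt1.
have Ld : in_semigroup q d by apply/(LambdaP q_gt0); do 2!eexists; apply: lines_weightE.
pose mon i := xy F (i %/ q - i %% q) (i %% q).
pose M : 'M[F]_(#|D|, K) :=
  \matrix_(i, k) ((footprint q d k)%:R * (mon k).@[(enum_val i : plane F)]).
have rM : (\rank M < #|D|)%N.
  apply: leq_ltn_trans (rank_zero_cols (S := [set i : 'I_K | footprint q d i]) _) _.
    by move=> i k; rewrite inE => /negPf fk; rewrite mxE fk mul0r.
  by rewrite cardD card_footprint.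
have : kermx M != 0 by rewrite kermx_eq0 /row_free neq_ltn rM.
case/rowV0Pn=> v /sub_kermxP vM v0.
pose c := extension v.
have cnD P : P \notin D -> c P = 0 by exact: extension_out.
exists c; split=> //.
  case/rV0Pn: v0 => i vi; exists (enum_val i); by rewrite /c extension_val.
suff vb k : (k <= K)%N -> vanish_below q c k by exact: vb.
elim: k => [|k IHk] le_k a b; first by [].
have cE : supported_on_curve q c.
  by move=> P nE; apply: cnD; rewrite inE (negPf nE).
have {IHk}cv := IHk (ltnW le_k).
rewrite ltnS leq_eqVlt => /orP[/eqP ek|]; last exact: cv.
have Lk : in_semigroup q k by apply/(LambdaP q_gt0); exists a, b.
have [fk|] := boolP (footprint q d k).
  rewrite (pairing_weight q_gt1 cE cv ek (in_semigroup_weight Lk)) pairing_extension.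
  have := congr1 (fun A : 'rV_K => A 0 (Ordinal le_k)) vM; rewrite !mxE => E0.
  by rewrite -[RHS]E0; apply: eq_bigr => i _; rewrite mxE fk mul1r.
rewrite /footprint Lk /= negbK => /andP[le_d Lkd].
rewrite -(subnK le_d) in ek.
have := @pairing_lead c k ls ((k - d) %/ q - (k - d) %% q) ((k - d) %% q) cv.
rewrite in_semigroup_weight // subnK // leqnn => /(_ isT) lead.
rewrite subnK // in ek.
rewrite (pairing_weight q_gt1 cE cv ek
  (a' := (k - d) %/ q - (k - d) %% q + count (fun l => l.1 == ord0) ls)
  (b' := (k - d) %% q + count (fun l => l.1 == ord_max) ls)); last first.
  by rewrite !mulnDl addnACA -lines_weightE in_semigroup_weight // subnK.
rewrite -lead; apply: big1 => P _.
have [PD|/cnD->] := boolP (P \in D); last by rewrite mul0r.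
have : (lines_poly ls).@[P] = 0.
  by apply/eqP; rewrite meval_lines; move: PD; rewrite inE => /andP[].
by move=> l0; rewrite mevalM l0 !mulr0.
Qed.

Definition lift_uni (j : 'I_2) (h : {poly F}) : {mpoly F[2]} :=
  (map_poly (@mpolyC 2 F) h).['X_j].

Lemma meval_lift_uni j h P : (lift_uni j h).@[P] = h.[P j].
Proof.
rewrite /lift_uni -(horner_map (meval P)) -map_poly_comp /= mevalXU.
congr (_.[_]); rewrite -[RHS](map_poly_id (g := idfun)) //.
by apply: eq_map_poly => x /=; rewrite mevalC.
Qed.

(** The polynomials with such a decomposition form a subring containing the
    constants and both variables. *)
Lemma division_line (i j : 'I_2) x : i != j -> forall f : {mpoly F[2]},
  exists g h, f = g * line (i, x) + lift_uni j h.
Proof.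
move=> ij; pose red f := exists g h, f = g * line (i, x) + lift_uni j h.
have redD f f' : red f -> red f' -> red (f + f').
  move=> [g [h ->]] [g' [h' ->]]; exists (g + g'), (h + h').
  by rewrite /lift_uni rmorphD hornerD; ring.
have redM f f' : red f -> red f' -> red (f * f').
  move=> [g [h ->]] [g' [h' ->]].
  exists (g * g' * line (i, x) + g * lift_uni j h' + g' * lift_uni j h), (h * h').
  by rewrite /lift_uni rmorphM hornerM; ring.
have redC a : red a%:MP.
  by exists 0, a%:P; rewrite /lift_uni map_polyC hornerC mul0r add0r.
have redX k : red 'X_k.
  have [->|ki] := eqVneq k i.
    by exists 1, x%:P; rewrite /lift_uni map_polyC hornerC /line mul1r subrK.
  rewrite (ord2_other ij ki).
  by exists 0, 'X; rewrite /lift_uni map_polyX hornerX mul0r add0r.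
move=> f; rewrite -/(red f); elim/mpolyind: f => [|a u f _ _ IHf]; first exact: (redC 0).
apply: redD IHf; rewrite -mul_mpolyC; apply: (redM _ _ (redC a)).
rewrite mpolyXE_id; apply: big_ind => [||k _]; [exact: (redC 1)|exact: redM|].
by elim: (u k) => [|n IHn]; [exact: (redC 1)|rewrite exprS; apply: redM].
Qed.

(** Here h is the equation of the curve restricted to the line.  Having as many
    roots as its degree, it is up to a constant the product of the linear factors
    at these roots, hence divides any univariate polynomial vanishing there. *)
Lemma split_good_line (i j : 'I_2) x g h : i != j -> h != 0 ->
  H = g * line (i, x) + lift_uni j h -> #|[set y | root h y]| = (size h).-1 ->
  index_weight i = (size h).-1 -> good_line (i, x).
Proof.
move=> ij h0 HE cardh wth.
pose pt y : plane F := [ffun k => if k == i then x else y].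
have pti y : pt y i = x by rewrite ffunE eqxx.
have ptj y : pt y j = y by rewrite ffunE eq_sym (negPf ij).
have memE (P : plane F) : P i = x -> (P \in E) = root h (P j).
  by move=> Pi; rewrite inE HE mevalD mevalM meval_line Pi subrr mulr0 add0r meval_lift_uni.
have zeroE : line_zeros (i, x) = pt @: [set y | root h y].
  apply/setP=> P; rewrite in_set /=; apply/andP/imsetP.
    case=> EP /eqP Pi; exists (P j); first by rewrite inE -memE.
    apply/ffunP=> k; rewrite ffunE; case: eqP => [->//|/eqP ki].
    by rewrite (ord2_other ij ki).
  by case=> y; rewrite inE => ry ->; rewrite memE ?pti ?ptj.
split=> [|f f0] /=.
  rewrite zeroE card_imset; first by rewrite cardh wth.
  by move=> y y' /(congr1 (fun P : plane F => P j)); rewrite !ptj.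
have [g' [h' fE]] := division_line x ij f.
have h'0 y : root h y -> root h' y.
  move=> ry; have : f.@[pt y] = 0 by apply: f0; rewrite zeroE imset_f ?inE.
  by rewrite fE mevalD mevalM meval_line pti subrr mulr0 add0r meval_lift_uni ptj rootE => ->.
have rs_root : all (root h) (enum [set y | root h y]).
  by apply/allP=> y; rewrite mem_enum inE.
have rs_uniq : uniq_roots (enum [set y | root h y]) by rewrite uniq_rootsE enum_uniq.
have sz : size h = (size (enum [set y | root h y])).+1.
  by rewrite -cardE cardh prednK ?size_poly_gt0.
have hE := all_roots_prod_XsubC sz rs_root rs_uniq.
have [|r h'E] := @uniq_roots_prod_XsubC _ h' _ _ rs_uniq.
  by apply/allP=> y; rewrite mem_enum inE => /h'0.
pose r' := (lead_coef h)^-1 *: r.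
have {}h'E : h' = r' * h.
  rewrite h'E; move: hE; set R := \prod_(_ <- _) _ => hE.
  by rewrite [in RHS]hE /r' -scalerAl -scalerAr scalerA mulVf ?scale1r ?lead_coef_eq0.
exists (lift_uni j r'), (g' - lift_uni j r' * g).
rewrite fE h'E [lift_uni j (_ * _)]/lift_uni rmorphM hornerM -!/(lift_uni _ _).
by rewrite (_ : lift_uni j h = H - g * line (i, x)); [ring|rewrite HE; ring].
Qed.

End Lines.

(** * Codewords as functionals *)

Lemma ideal_gen_eval (F : finFieldType) (gs : seq {mpoly F[2]}) (P : plane F) f :
  ideal_gen gs f -> {in gs, forall g : {mpoly F[2]}, g.@[P] = 0} -> f.@[P] = 0.
Proof.
move=> [a ->] g0; rewrite rmorph_sum big1 // => i _.
by rewrite /= mevalM (g0 gs`_i) ?mulr0 ?mem_nth.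
Qed.

Section Code.
Variables (F : finFieldType) (q : nat).
Hypothesis cardF : #|F| = (q ^ 2)%N.
Local Notation E := (hermitian_points F q).

(** The ideal of the rational points contributes nothing to the functional, so
    only the monomials of weight at most m are left to test. *)
Lemma hermitian_codeP m (c : 'rV[F]_#|E|) :
  hermitian_code m c <-> vanish_below q (extension c) m.+1.
Proof.
split=> [Cc a b lt_m|van v [f [g gm fg] ->]].
  rewrite pairing_extension; apply: etrans (Cc (evaluation E (xy F a b)) _); last first.
    exists (xy F a b) => //; exists (xy F a b); last first.
      exists (fun=> 0); rewrite subrr big1 // => i _; by rewrite mul0r.
    have -> : xy F a b = 'X_[(U_(ord0) *+ a + U_(ord_max) *+ b)%MM].
      by rewrite mpolyXD -!mpolyXn.
    move=> u; rewrite msuppX inE => /eqP->.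
    by rewrite /weight !mnmDE !mulmnE !mnm1E /= ?eqxx /=; lia.
  by apply: eq_bigr => i _; rewrite mxE.
under eq_bigr do rewrite mxE.
rewrite -pairing_extension.
have -> : pairing (extension c) f = pairing (extension c) g.
  apply: eq_bigr => P _; have [PE|nP] := boolP (P \in E); last first.
    by rewrite extension_out ?mul0r.
  congr (_ * _); apply/eqP; rewrite -subr_eq0 -mevalB; apply/eqP.
  apply: ideal_gen_eval fg _ => h; rewrite !inE => /or3P[]/eqP->.
  - by move: PE; rewrite inE => /eqP.
  - by rewrite mevalB rmorphXn /= mevalXU -cardF expf_card subrr.
  - by rewrite mevalB rmorphXn /= mevalXU -cardF expf_card subrr.
rewrite (mpolyE g) /pairing; under eq_bigr do rewrite raddf_sum mulr_sumr.
rewrite exchange_big big_seq big1 //= => u ug.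
have := van (u ord0) (u ord_max) (gm u ug); rewrite -mpolyX_xy => u0.
by have := pairingZ (extension c) g@_u 'X_[u]; rewrite u0 mulr0.
Qed.

Lemma support_extension (c : 'rV[F]_#|E|) :
  support_points c = [set P | extension c P != 0].
Proof.
apply/setP=> P; rewrite inE; apply/imsetP/idP.
  by case=> i; rewrite inE => ci ->; rewrite extension_val.
have [PE|nP] := boolP (P \in E); last by rewrite extension_out ?eqxx.
rewrite -(enum_rankK_in PE PE) extension_val => ci.
by exists (enum_rank_in PE P); rewrite ?inE.
Qed.

Lemma hamming_extension (c : 'rV[F]_#|E|) :
  hamming_weight c = #|[set P | extension c P != 0]|.
Proof. by rewrite -support_extension card_imset //; apply: enum_val_inj. Qed.

Lemma extension_on_curve (c : 'rV[F]_#|E|) : supported_on_curve q (extension c).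
Proof. by move=> P; apply: extension_out. Qed.

End Code.

Lemma msize_line (F : finFieldType) (l : 'I_2 * F) : msize (line l) = 2.
Proof.
apply/eqP; rewrite eqn_leq; apply/andP; split.
  apply: leq_trans (mmeasureD_le _ _ _) _.
  by rewrite mmeasureN mmeasureC msizeX mdeg1 geq_max /=; case: (_ != 0).
apply: leq_ltn_trans (_ : mdeg U_(l.1) < _)%N; first by rewrite mdeg1.
apply: msize_mdeg_lt.
rewrite mcoeff_msupp mcoeffB mcoeffXU eqxx mcoeffC mnm1_eq0 mulr0 subr0.
exact: oner_neq0.
Qed.

Section Configuration.
Variables (F : finFieldType) (p e q : nat).
Hypotheses (p_prime : prime p) (e_gt0 : (0 < e)%N) (q_def : q = (p ^ e)%N).
Hypothesis cardF : #|F| = (q ^ 2)%N.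
Let q1 := q_gt1 p_prime e_gt0 q_def.

Lemma vertical_good (x : F) : good_line q (ord0, x).
Proof.
have sz : (size (trace_poly q (x ^+ q.+1))).-1 = q.
  by rewrite (size_trace_poly p_prime e_gt0 q_def).
apply: (@split_good_line _ q _ ord_max _
  (\sum_(i < q.+1) pX ^+ (q.+1.-1 - i) * x%:MP ^+ i) (trace_poly q (x ^+ q.+1))) => //.
- by rewrite -size_poly_gt0 (size_trace_poly p_prime e_gt0 q_def).
- rewrite mulrC /line -/pX /= -subrXX /hermitian_poly /lift_uni /trace_poly.
  rewrite rmorphB rmorphD /= map_polyC map_polyXn map_polyX /= !hornerE -/pY.
  by rewrite rmorphXn /=; ring.
- by rewrite (card_trace_fibre p_prime e_gt0 q_def cardF) ?(norm_frob_fixed cardF) ?sz.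
Qed.

Lemma horizontal_good (y : F) : y ^+ q + y = 1 -> good_line q (ord_max, y).
Proof.
move=> y1.
have sz : (size (norm_poly q (1 : F))).-1 = q.+1 by rewrite size_norm_poly.
apply: (@split_good_line _ q _ ord0 _
  (- (\sum_(i < q) pY ^+ (q.-1 - i) * y%:MP ^+ i) - 1) (norm_poly q 1)) => //.
- by rewrite -size_poly_gt0 size_norm_poly.
- rewrite mulrC mulrBr mulrN /line -/pY /= -subrXX /hermitian_poly /lift_uni /norm_poly.
  rewrite rmorphB /= map_polyC map_polyXn /= !hornerE -/pX.
  by rewrite -y1 rmorphD rmorphXn /=; ring.
- by rewrite (card_norm1 p_prime e_gt0 q_def cardF) sz.
Qed.

(** A vertical line X = x and a horizontal line Y = y meet on the curve only if
    the norm of x equals the trace of y, which the choice of norms different from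
    1 and traces equal to 1 excludes.  There are q ^ 2 - q - 1 such x and q
    such y, which suffices since d <= q * (q - 1). *)
Lemma exists_lines d : (0 < d)%N -> in_semigroup q d -> (d <= q * q.-1)%N ->
  exists ls : seq ('I_2 * F), [/\ lines_weight q ls = d, pairwise (disjoint_lines q) ls
   & {in ls, forall l, good_line q l}].
Proof.
move=> d_gt0 Ld le_d; set u := (d %/ q - d %% q)%N; set v := (d %% q)%N.
pose SX := [set x : F | x ^+ q.+1 != 1]; pose SY := [set y : F | y ^+ q + y == 1].
have q_gt0 := ltnW q1.
have cSY : #|SY| = q.
  have S1 : (1 : F) \in frob_fixed F q by rewrite inE expr1n.
  rewrite -[RHS](card_trace_fibre p_prime e_gt0 q_def cardF S1).
  by apply: eq_card => y; rewrite !inE root_trace_poly.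
have cSX : (#|SX| = q ^ 2 - q.+1)%N.
  rewrite cardsCs cardF -(card_norm1 p_prime e_gt0 q_def cardF); congr (_ - _)%N.
  by apply: eq_card => y; rewrite !inE negbK root_norm_poly.
have le_q : (d %/ q <= q.-1)%N by rewrite -(mulnK q.-1 q_gt0) leq_div2r // mulnC.
have le_u : (u <= size (enum SX))%N.
  by rewrite -cardE cSX /u -mulnn; have := q1; nia.
have le_v : (v <= size (enum SY))%N by rewrite -cardE cSY ltnW // ltn_mod.
pose lx := [seq (ord0 : 'I_2, x) | x <- take u (enum SX)].
pose ly := [seq (ord_max : 'I_2, y) | y <- take v (enum SY)].
have lxP l : l \in lx -> l.1 = ord0 /\ l.2 ^+ q.+1 != 1.
  by case/mapP=> x /mem_take; rewrite mem_enum inE => x1 ->.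
have lyP l : l \in ly -> l.1 = ord_max /\ l.2 ^+ q + l.2 = 1.
  by case/mapP=> x /mem_take; rewrite mem_enum inE => /eqP x1 ->.
exists (lx ++ ly); split.
- rewrite /lines_weight big_cat !big_map /index_weight /= !big_const_seq
    !count_predT !iter_addn_0.
  rewrite !size_takel // [(q * _)%N]mulnC [(q.+1 * _)%N]mulnC /u /v.
  exact: in_semigroup_weight.
- have uls : uniq (lx ++ ly).
    rewrite cat_uniq !map_inj_uniq ?take_uniq ?enum_uniq //; try by move=> ? ? [].
    rewrite andbT; apply/hasPn=> l /lyP[l1 _]; apply/negP=> /lxP[l0 _].
    by rewrite l0 in l1.
  move: uls; rewrite uniq_pairwise; apply: sub_in_pairwise (allss _).
  move=> l l' lls l'ls /= nl; apply/pred0P=> P /=; apply/negP=> /andP[].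
  rewrite ![_ \in line_zeros _ _]in_set => /andP[EP /eqP Pl] /andP[_ /eqP Pl'].
  move: lls l'ls; rewrite !mem_cat.
  have HP := EP; rewrite mem_hermitian_points in HP.
  case: l l' nl Pl Pl' => [i x] [i' x'] /= nl Pl Pl'.
  move=> /orP[/lxP|/lyP][/= ei ex] /orP[/lxP|/lyP][/= ei' ex']; subst i i'; subst x x'.
  + by rewrite eqxx in nl.
  + by move: HP; rewrite ex' (negPf ex).
  + by move: HP; rewrite ex (negPf ex').
  + by rewrite eqxx in nl.
- move=> [i x]; rewrite mem_cat => /orP[/lxP|/lyP][/= -> h].
    exact: vertical_good.
  exact: horizontal_good.
Qed.

End Configuration.

(** * The distance and the minimum-weight supports *)

Local Close Scope ring_scope.

(** With d = a q + b, the exponents are (a - 1, q - 1) if b = 0, (q, b - 1) if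
    a = b > 0, and (a - b - 1, b - 1 + q) otherwise. *)
Lemma Lambda_B_next q d : 1 < q -> in_semigroup q d -> 0 < d -> d <= q * q.-1 ->
  Lambda_B q (d + q * q.-1).-1.
Proof.
case: q => [|[|r]] // _ Ld d0 le_d; set q := r.+2 in Ld le_d *.
have q_gt0 : 0 < q by [].
have qr : q = r.+2 by [].
set a := d %/ q; set b := d %% q.
have b_lt : b < q by rewrite ltn_mod.
have ba : b <= a by [].
have dE : d = a * q + b by rewrite [LHS](divn_eq d q).
have a_le : a <= q.-1 by rewrite -(mulnK q.-1 q_gt0) leq_div2r // mulnC.
have sol i j : i <= q -> j <= q ^ 2 - q - 1 -> (d + q * q.-1).-1 = i * q + j * q.+1 ->
    Lambda_B q (d + q * q.-1).-1.
  move=> iq jq E; exists (U_(ord0) *+ i + U_(ord_max) *+ j)%MM.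
    by left; rewrite !mnmDE !mulmnE !mnm1E /= ?eqxx /=; lia.
  by rewrite E /weight !mnmDE !mulmnE !mnm1E /= ?eqxx /=; lia.
have [b0|b_gt0] := posnP b.
  have ea : a = a.-1.+1.
    by rewrite prednK // lt0n; apply: contraTneq d0 => a0; rewrite dE a0 b0.
  apply: (sol a.-1 q.-1); rewrite -?mulnn; [nia|nia|].
  by rewrite dE b0 {1}ea qr /=; lia.
have a_lt : a < q.-1.
  rewrite ltn_neqAle a_le andbT; apply: contraTneq le_d => aq; rewrite -ltnNge; nia.
have [ab|] := eqVneq a b.
  by apply: (sol q b.-1); rewrite -?mulnn; nia.
move=> nab; apply: (sol (a - b.+1) (b.-1 + q)); rewrite -?mulnn; nia.
Qed.

Theorem theorem4p2 (p e q m : nat) (F : finFieldType)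
    (p_prime : prime p) (e_gt0 : (0 < e)%N) (q_def : q = (p ^ e)%N)
    (cardF : #|F| = (q ^ 2)%N)
    (m_range : (q ^ 2 - q - 1 <= m <= 2 * q ^ 2 - 2 * q - 3)%N) :
  (exists2 mt : nat, is_tilde q m mt &
     is_distance (@hermitian_code F q m) (delta q mt)) /\
  (exists2 D : {set plane F}, min_weight_support q m D &
     exists2 G : {mpoly F[2]}, union_of_lines G & cut_by q D G).
Proof.
have q1 := q_gt1 p_prime e_gt0 q_def; have q_gt0 := ltnW q1.
have deltaE k : delta q k = k + 2 - q * q.-1 by rewrite /delta -mulnn; nia.
have [d nd] := exists_next q_gt0 (delta q m); have [Ld le_d dmin] := nd.
case/andP: m_range; rewrite -mulnn => m_ge m_le.
have le_d' : d <= q * q.-1 by apply: dmin; rewrite ?in_semigroup_large // deltaE; nia.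
have d_gt0 : 0 < d by apply: leq_trans le_d; rewrite deltaE; nia.
(* delta q mt = d, so mt is the value that [is_tilde] must single out. *)
set mt := d + q * q.-1 - 2.
have W2 : 1 < q * q.-1 by nia.
have dmt : delta q mt = d by rewrite deltaE /mt; lia.
have lower (c : 'rV[F]_#|hermitian_points F q|) :
    hermitian_code m c -> c != 0%R -> d <= hamming_weight c.
  move=> /(hermitian_codeP cardF) cv c0; rewrite hamming_extension.
  apply: (weight_lower_bound q1 _ (extension_on_curve c) cv); first by nia.
    by rewrite -deltaE.
  by case/rV0Pn: c0 => i ci; exists (enum_val i); rewrite extension_val.
have [ls [wls dls gls]] := exists_lines p_prime e_gt0 q_def cardF d_gt0 Ld le_d'.
have cls := card_lines_zeros dls gls.
have [|c' [[P cP] cout cv]] := @dual_word_on_lines F q q1 ls _ cls; first by rewrite wls.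
pose c : 'rV[F]_#|hermitian_points F q| := (\row_i c' (enum_val i))%R.
have cE Q : extension c Q = c' Q.
  have [EQ|nE] := boolP (Q \in hermitian_points F q).
    by rewrite -(enum_rankK_in EQ EQ) extension_val mxE.
  by rewrite extension_out // cout // inE (negPf nE).
have Cc : hermitian_code m c.
  apply/(hermitian_codeP cardF) => a b lt_m.
  rewrite -[RHS](cv a b); last by rewrite wls; move: le_d; rewrite deltaE; nia.
  by apply: eq_bigr => Q _; rewrite cE.
have c0 : c != 0%R.
  apply: contraNneq cP => c0; rewrite -cE c0.
  by rewrite /extension big1 // => i _; rewrite mxE mul0r.
have sub_D : support_points c \subset lines_zeros q ls.
  rewrite support_extension; apply/subsetP=> Q; rewrite inE cE => cQ.
  by apply: contraNT cQ => /cout->.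
have wc : hamming_weight c = #|support_points c|.
  by rewrite hamming_extension support_extension.
have suppE : support_points c = lines_zeros q ls.
  by apply/eqP; rewrite eqEcard sub_D -wc cls wls lower.
have wcd : hamming_weight c = d by rewrite wc suppE cls wls.
have dist : is_distance (@hermitian_code F q m) d.
  by split=> [|w [x [Cx x0 <-]]]; [exists c | apply: lower].
split.
  exists mt; rewrite ?dmt //; split.
    rewrite dmt; split; last exact/(LambdaP q_gt0).
      by move: le_d; rewrite /mt deltaE; lia.
    by have -> : mt.+1 = (d + q * q.-1).-1; [rewrite /mt; lia|apply: Lambda_B_next].
  move=> j [mj _ /(LambdaP q_gt0) Lj].
  have : d <= delta q j by apply: dmin => //; rewrite !deltaE; lia.
  by rewrite deltaE /mt; lia.
exists (lines_zeros q ls); first by exists c; split=> //; rewrite wcd.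
exists (lines_poly ls).
  exists (map (@line F) ls); last by rewrite /lines_poly big_map.
  by move=> _ /mapP[l _ ->]; apply: msize_line.
move=> f; split=> [f0|If Q QD].
  have [a [b ->]] := lines_cut dls gls f0.
  exists (fun i => if i is 0 then a else b).
  by rewrite big_ord_recl big_ord1.
apply: ideal_gen_eval If _ => g; rewrite !inE.
move: QD; rewrite inE => /andP[QE Ql] /orP[]/eqP->; apply/eqP.
  by move: QE; rewrite inE.
by rewrite meval_lines.
Qed.
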